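(* For every integer $t\ge 1$, if a graph $G$ is $tP_1$-pivot-unique, then $|V(G)|\le 2^t-1$.
   Context: Graphs are finite, without loops or multiple edges. $tP_1$ is the graph with $t$ vertices and no edges. For a vertex $u$ of a graph $G$, the local complementation $G*u$ is obtained from $G$ by complementing the adjacency between every pair of distinct neighbours of $u$. For an edge $uv$ of $G$, the edge pivot is $G\wedge uv=((G*u)*v)*u$. A graph $G$ contains $H$ as a pivot-minor if $H$ can be obtained from $G$ by a sequence of vertex deletions and edge pivots. Two graphs are pivot-equivalent if one can be obtained from the other by a sequence of edge pivots. For a vertex $v$ of $G$, write $G/v$ for $(G\wedge zv)-v$, where $z$ is a neighbour of $v$, and $G/v=G-v$ if $v$ is isolated; the choice of $z$ does not affect $G/v$ up to pivot-equivalence. For a graph $H$, a graph $G$ is $H$-pivot-unique if $G$ contains a pivot-minor isomorphic to $H$ and, for every vertex $v$ of $G$, at most one of $G-v$ and $G/v$ contains a pivot-minor isomorphic to $H$. *)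

(* Defs.v *)
From mathcomp Require Import all_boot.
Set Implicit Arguments. Unset Strict Implicit. Unset Printing Implicit Defensive.

Record sgraph := SGraph {
  svertex :> finType;
  sedge : rel svertex;
  sedge_sym : symmetric sedge;
  sedge_irrefl : irreflexive sedge }.

Definition graph_iso (G H : sgraph) : Prop :=
  exists2 f : G -> H, bijective f & forall x y, sedge (f x) (f y) = sedge x y.

(* [addb] flips the adjacency of x and y exactly when they are two distinct
   neighbours of u. *)
Definition local_rel (G : sgraph) (u : G) : rel G :=
  fun x y => sedge x y (+) [&& x != y, sedge u x & sedge u y].

Lemma local_sym (G : sgraph) (u : G) : symmetric (local_rel u).
Proof.
by move=> x y; rewrite /local_rel sedge_sym eq_sym [sedge u x && _]andbC.
Qed.

Lemma local_irrefl (G : sgraph) (u : G) : irreflexive (local_rel u).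
Proof. by move=> x; rewrite /local_rel sedge_irrefl eqxx. Qed.

Definition local_compl (G : sgraph) (u : G) : sgraph :=
  SGraph (local_sym u) (@local_irrefl G u).

(* G /\ uv = ((G * u) * v) * u.  The three graphs share the vertex type of G.
   This is total in u and v; it is only ever used when uv is an edge of G. *)
Definition pivot (G : sgraph) (u v : G) : sgraph :=
  @local_compl (@local_compl (@local_compl G u) v) u.

Definition del_rel (G : sgraph) (v : G) : rel {x : G | x != v} :=
  fun x y => sedge (val x) (val y).

Lemma del_sym (G : sgraph) (v : G) : symmetric (@del_rel G v).
Proof. by move=> x y; apply: sedge_sym. Qed.

Lemma del_irrefl (G : sgraph) (v : G) : irreflexive (@del_rel G v).
Proof. by move=> x; apply: sedge_irrefl. Qed.

Definition del_vertex (G : sgraph) (v : G) : sgraph :=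
  SGraph (@del_sym G v) (@del_irrefl G v).

Inductive pivot_reachable (G : sgraph) : sgraph -> Prop :=
| pr_refl : pivot_reachable G G
| pr_del (K : sgraph) (v : K) :
    pivot_reachable G K -> pivot_reachable G (del_vertex v)
| pr_pivot (K : sgraph) (u v : K) :
    sedge u v -> pivot_reachable G K -> pivot_reachable G (pivot u v).

Definition has_pivot_minor (G H : sgraph) : Prop :=
  exists2 K, pivot_reachable G K & graph_iso K H.

(* G / v.  The neighbour z is the one selected by [pick]; another choice gives
   a pivot-equivalent graph, hence one with the same pivot-minors. *)
Definition contract (G : sgraph) (v : G) : sgraph :=
  if [pick z | sedge z v] is Some z then @del_vertex (pivot z v) v
  else del_vertex v.

(* "At most one" counts the two operations, not the resulting graphs: when v is
   isolated, G - v and G / v coincide and neither may contain H. *)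
Definition pivot_unique (H G : sgraph) : Prop :=
  has_pivot_minor G H /\
  forall v : G,
    ~ (has_pivot_minor (del_vertex v) H /\ has_pivot_minor (contract v) H).

Lemma no_edge_sym t : symmetric (fun _ _ : 'I_t => false).
Proof. by []. Qed.

Lemma no_edge_irrefl t : irreflexive (fun _ _ : 'I_t => false).
Proof. by []. Qed.

(* t P_1 *)
Definition edgeless (t : nat) : sgraph :=
  SGraph (@no_edge_sym t) (@no_edge_irrefl t).

(* Main.v *)
Require Import Defs.
From mathcomp Require Import all_boot.

(** Record a graph e by the relation "b is the sum over GF(2) of the
    neighbourhoods of the vertices in a".  A pivot on uv exchanges a and b at the
    two coordinates u and v, so pivot-equivalent graphs differ by exchanging
    coordinates on a set Y, and G - v and G / v account for the exchanges with
    v outside Y and v inside Y respectively.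

    Hence, if I is an independent t-set of a graph pivot-equivalent to a
    pivot-unique G and v is outside I, no pivot on an edge at v may leave an
    independent t-set avoiding v.  This forces v to have at least two neighbours
    in I, and two vertices outside I to have different neighbourhoods in I: if
    v and w have the same one, containing z, then after pivoting zv the vertex w
    has v as only neighbour in the independent set I - z + v.  Together with the
    singletons of I these neighbourhoods are distinct nonempty subsets of I. *)

Set Implicit Arguments. Unset Strict Implicit. Unset Printing Implicit Defensive.

(** * Local complementation and pivots as relations on a fixed vertex type *)

Section Relations.

Variable T : finType.
Implicit Types (e : rel T) (u v x y : T) (a b S : T -> bool) (X Y Z I : {set T}).

(** Bare relations on one type keep sets of vertices comparable along a sequence of pivots;
    deletions, which change the type, are left to embeddings. *)
Definition lcomp e u : rel T :=
  fun x y => e x y (+) [&& x != y, e u x & e u y].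

Definition rpivot e u v : rel T := lcomp (lcomp (lcomp e u) v) u.

Lemma lcomp_sym e u : symmetric e -> symmetric (lcomp e u).
Proof.
by move=> es x y; rewrite /lcomp es eq_sym [e u x && _]andbC.
Qed.

Lemma lcomp_irrefl e u : irreflexive e -> irreflexive (lcomp e u).
Proof. by move=> ei x; rewrite /lcomp ei eqxx. Qed.

Lemma rpivot_sym e u v : symmetric e -> symmetric (rpivot e u v).
Proof. by move=> es; do 3 apply: lcomp_sym. Qed.

Lemma rpivot_irrefl e u v : irreflexive e -> irreflexive (rpivot e u v).
Proof. by move=> ei; do 3 apply: lcomp_irrefl. Qed.

Section Pivot.

Variables (e : rel T) (u v : T).
Hypotheses (es : symmetric e) (ei : irreflexive e) (uv : e u v).

Lemma adj_neq x y : e x y -> x != y.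
Proof. by apply: contraTneq => ->; rewrite ei. Qed.

Let nuv : u != v. Proof. exact: adj_neq. Qed.

Let vu : e v u. Proof. by rewrite es. Qed.

Lemma rpivot_edge : rpivot e u v u v.
Proof.
by rewrite /rpivot /lcomp !ei ?eqxx (negbTE nuv) [v == u]eq_sym (negbTE nuv) uv vu /=.
Qed.

Lemma rpivot_l y : y != u -> y != v -> rpivot e u v u y = e v y.
Proof.
move=> yu yv; rewrite /rpivot /lcomp !ei ?eqxx /= ![_ == y]eq_sym yu yv.
rewrite ?(negbTE nuv) ?[v == u]eq_sym ?(negbTE nuv) ?uv ?vu /=.
by case: (e u y); case: (e v y).
Qed.

Lemma rpivot_r y : y != u -> y != v -> rpivot e u v v y = e u y.
Proof.
move=> yu yv; rewrite /rpivot /lcomp !ei ?eqxx /= ![_ == y]eq_sym yu yv.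
rewrite ?(negbTE nuv) ?[v == u]eq_sym ?(negbTE nuv) ?uv ?vu /=.
by case: (e u y); case: (e v y).
Qed.

Lemma rpivot_out x y : x != u -> x != v -> y != u -> y != v ->
  rpivot e u v x y = e x y (+) (e u x && e v y (+) e v x && e u y).
Proof.
move=> xu xv yu yv; rewrite /rpivot /lcomp !ei ?eqxx /= ![u == _]eq_sym ![v == _]eq_sym.
rewrite xu xv yu yv ?(negbTE nuv) ?[v == u]eq_sym ?(negbTE nuv) ?uv ?vu.
case: (eqVneq x y) => [->|_] /=; first by rewrite ei; case: (e u y); case: (e v y).
by case: (e u y); case: (e v y); case: (e u x); case: (e v x); case: (e x y).
Qed.

End Pivot.

Lemma rpivotK e u v : symmetric e -> irreflexive e -> e u v ->
  rpivot (rpivot e u v) u v =2 e.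
Proof.
move=> es ei uv.
have ps := @rpivot_sym e u v es; have pi := @rpivot_irrefl e u v ei.
have puv := rpivot_edge es ei uv.
have ss := @rpivot_sym _ u v ps; have si := @rpivot_irrefl _ u v pi.
have main x y : x != u -> x != v ->
    rpivot (rpivot e u v) u v x y = e x y.
  move=> xu xv; case: (eqVneq y u) => [->|yu].
    by rewrite ss rpivot_l // rpivot_r // es.
  case: (eqVneq y v) => [->|yv]; first by rewrite ss rpivot_r // rpivot_l // es.
  rewrite (rpivot_out ps) // (rpivot_out es ei uv xu xv yu yv).
  rewrite !(rpivot_l es ei uv) // !(rpivot_r es ei uv) //.
  by case: (e u y); case: (e v y); case: (e u x); case: (e v x); case: (e x y).
move=> x y.
have [/andP[xu xv]|] := boolP ((x != u) && (x != v)); first exact: main.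
have [/andP[yu yv] _|] := boolP ((y != u) && (y != v)).
  by rewrite ss es main.
have suv := rpivot_edge ps pi puv.
rewrite !negb_and !negbK => /orP[] /eqP-> /orP[] /eqP->; rewrite ?si ?ei // ?suv ?uv //.
by rewrite ss es suv uv.
Qed.

(** * Adjacency matrices over GF(2) and the exchange of coordinates *)

Definition oddN e S : T -> bool :=
  fun x => \big[addb/false]_y (e x y && S y).

Lemma eq_oddN e e' S S' : e =2 e' -> S =1 S' -> oddN e S =1 oddN e' S'.
Proof. by move=> ee SS x; apply: eq_bigr => y _; rewrite ee SS. Qed.

Lemma oddN1 e y : oddN e (pred1 y) =1 e^~ y.
Proof.
move=> x; rewrite /oddN (bigD1 y) //= eqxx andbT big1 ?addbF // => z /negbTE.
by move=> /= ->; rewrite andbF.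
Qed.

Definition swap Y a b : T -> bool := fun x => if x \in Y then b x else a x.

(** This is the principal pivot transform on [Y] over GF(2): exchanging the coordinates in [Y]
    carries the graph of the linear map [oddN e] into that of [oddN e']. Quantifying over vectors
    avoids inverting a submatrix. *)
Definition twist e Y e' :=
  forall S, oddN e' (swap Y S (oddN e S)) =1 swap Y (oddN e S) S.

Lemma twist0_eq e e' : twist e set0 e' -> e =2 e'.
Proof.
move=> tw x y; have := tw (pred1 y) x.
rewrite (eq_oddN (e' := e') (S' := pred1 y)) //; last by move=> z; rewrite /swap inE.
by rewrite /swap inE !oddN1.
Qed.

Lemma twist_refl e : twist e set0 e.
Proof.
move=> S x; rewrite /swap inE; apply: eq_oddN => // y.
by rewrite inE.
Qed.

Definition symd Y Z : {set T} := [set x | (x \in Y) (+) (x \in Z)].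

(** A coordinate exchanged twice is back in place, so only the symmetric difference remains. *)
Lemma twist_trans e Y e' Z e'' :
  twist e Y e' -> twist e' Z e'' -> twist e (symd Y Z) e''.
Proof.
move=> tw tw' S x.
have := tw' (swap Y S (oddN e S)) x.
have -> : swap Z (oddN e' (swap Y S (oddN e S))) (swap Y S (oddN e S)) x
        = swap (symd Y Z) (oddN e S) S x.
  by rewrite /swap inE tw /swap; case: (x \in Y); case: (x \in Z).
move=> <-; apply: eq_oddN => // y.
by rewrite /swap inE tw /swap; case: (y \in Y); case: (y \in Z).
Qed.

Lemma eq_twist e1 e2 Y e' : e1 =2 e2 -> twist e' Y e1 -> twist e' Y e2.
Proof. by move=> ee tw S x; rewrite -tw; apply: eq_oddN => // a b; rewrite ee. Qed.

Lemma oddN_split e S u v x : u != v ->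
  oddN e S x = (e x u && S u) (+) (e x v && S v)
    (+) \big[addb/false]_(y | (y != u) && (y != v)) (e x y && S y).
Proof.
by move=> uv; rewrite /oddN (bigD1 u) //= (bigD1 v) 1?eq_sym //= addbA.
Qed.

(** Since [uv] is an edge, row [u] can be solved for [S v] and row [v] for [S u]. Substituting both
    into the other rows adds exactly the correction term of [rpivot_out]. *)
Lemma twist_rpivot e u v : symmetric e -> irreflexive e -> e u v ->
  twist e [set u; v] (rpivot e u v).
Proof.
move=> es ei uv S x.
have nuv := adj_neq ei uv; have vu : e v u by rewrite es.
have ps := @rpivot_sym e u v es; have pi := @rpivot_irrefl e u v ei.
have puv := rpivot_edge es ei uv.
(* The part of row [w] that involves only coordinates left in place. *)
pose R w := \big[addb/false]_(y | (y != u) && (y != v)) (e w y && S y).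
have bu : oddN e S u = S v (+) R u by rewrite (oddN_split _ _ _ nuv) ei uv.
have bv : oddN e S v = S u (+) R v by rewrite (oddN_split _ _ _ nuv) ei vu /= addbF.
rewrite (oddN_split _ _ _ nuv) {1 2}/swap !inE !eqxx orbT /= bu bv.
rewrite (eq_bigr (fun y => rpivot e u v x y && S y)); last first.
  by move=> y /andP[/negbTE yu /negbTE yv]; rewrite /swap !inE yu yv.
have [->|xu] := eqVneq x u.
  rewrite pi puv (eq_bigr (fun y => e v y && S y)); last first.
    by move=> y /andP[yu yv]; rewrite rpivot_l.
  by rewrite -/(R v) /swap !inE eqxx /= addbK.
have [->|xv] := eqVneq x v.
  rewrite pi ps puv (eq_bigr (fun y => e u y && S y)); last first.
    by move=> y /andP[yu yv]; rewrite rpivot_r.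
  by rewrite -/(R u) /swap !inE eqxx orbT /= addbF addbK.
rewrite /swap !inE (negbTE xu) (negbTE xv) /= ps rpivot_l // [rpivot _ _ _ x v]ps rpivot_r //.
rewrite (oddN_split _ _ _ nuv) -/(R x) [e x u]es [e x v]es.
rewrite (eq_bigr (fun y => (e x y && S y) (+)
   ((e u x && (e v y && S y)) (+) (e v x && (e u y && S y))))); last first.
  move=> y /andP[yu yv]; rewrite rpivot_out //.
  by case: (S y); case: (e u y); case: (e v y); case: (e u x); case: (e v x); case: (e x y).
rewrite !big_split /= -!big_distrr /= -/(R x) -/(R u) -/(R v).
by case: (R x); case: (R u); case: (R v); case: (e u x); case: (e v x); case: (S u); case: (S v).
Qed.

Lemma rpivot_twist e u v : symmetric e -> irreflexive e -> e u v ->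
  twist (rpivot e u v) [set u; v] e.
Proof.
move=> es ei uv; apply: eq_twist (rpivotK es ei uv) _; apply: twist_rpivot.
- exact: rpivot_sym.
- exact: rpivot_irrefl.
- exact: rpivot_edge.
Qed.

(** Otherwise the exchange on [Y] sends the unit vector at [y] to the zero input, while the output
    at [y] should be 1. *)
Lemma twist_neighbor e Y e' y :
  symmetric e -> twist e Y e' -> y \in Y -> exists2 z, z \in Y & e y z.
Proof.
move=> es tw yY; apply/exists_inP; apply: contraT; rewrite negb_exists_in.
move=> /forall_inP none; have := tw (pred1 y) y.
rewrite {2}/swap yY /= eqxx /oddN big1 // => z _.
rewrite /swap; case: ifPn => [zY|zY]; last first.
  by rewrite /= (_ : (z == y) = false) ?andbF //; apply: contraNF zY => /eqP->.
by rewrite -/(oddN _ _ _) oddN1 es (negbTE (none z zY)) andbF.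
Qed.

(** A zero row of [e'] makes every output at [v] zero. The unit vector at [v] then excludes [v] from
    [Y], and the unit vectors at the other vertices show that row [v] of [e] is zero. *)
Lemma twist_isolated e Y e' v :
  symmetric e -> twist e Y e' -> e' v =1 xpred0 -> e v =1 xpred0.
Proof.
move=> es tw iso w.
have Z S : oddN e' S v = false by apply: big1 => z _; rewrite iso.
have vY : v \notin Y.
  by apply: contraT; rewrite negbK => vY; have := tw (pred1 v) v; rewrite Z /swap vY /= eqxx.
by have := tw (pred1 w) v; rewrite Z /swap (negbTE vY) oddN1.
Qed.

Definition indep e I := {in I &, forall x y, e x y = false}.

End Relations.

(** * Induced subgraphs, and pivot-minors obtained from twists *)

Definition emb (H : sgraph) (T : finType) (e : rel T) (f : H -> T) :=
  injective f /\ forall x y, sedge x y = e (f x) (f y).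

Section Embeddings.

Variable T : finType.
Implicit Types (e : rel T) (H K : sgraph) (X Y I : {set T}).

Lemma lcomp_inj (U : finType) (d : rel U) e (f : U -> T) u :
  injective f -> (forall x y, d x y = e (f x) (f y)) ->
  forall x y, lcomp d u x y = lcomp e (f u) (f x) (f y).
Proof. by move=> fi fe x y; rewrite /lcomp !fe (inj_eq fi). Qed.

Lemma emb_pivot H e (f : H -> T) (u v : H) :
  emb e f -> @emb (pivot u v) T (rpivot e (f u) (f v)) f.
Proof. by case=> fi fe; split=> //; do 3 apply: lcomp_inj => //. Qed.

Lemma emb_del H e (f : H -> T) (v : H) :
  emb e f -> @emb (del_vertex v) T e (f \o val).
Proof.
by case=> fi fe; split=> [x y /fi /val_inj|x y] //=; rewrite -fe.
Qed.

(** By [twist_neighbor] a nonempty [Y] spans an edge of [e]; pivoting on it removes both ends from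
    [Y]. All these pivots take place inside the image of [f]. *)
Lemma twist_reach (G : sgraph) e' Y : forall H e (f : H -> T),
  symmetric e -> irreflexive e -> twist e Y e' -> emb e f ->
  {subset Y <= codom f} -> pivot_reachable G H ->
  exists K (g : K -> T),
    [/\ pivot_reachable G K, emb e' g & codom g =i codom f].
Proof.
have [n] := ubnP #|Y|; elim: n Y => // n IHn Y leYn H e f es ei tw ef sYf GH.
have [Y0|[y yY]] := set_0Vmem Y.
  rewrite Y0 in tw; case: ef => fi fe; exists H, f; split=> //; split=> // x z.
  by rewrite -(twist0_eq tw).
have [z zY yz] := twist_neighbor es tw yY.
have [u def_y] := codomP (sYf y yY); have [v def_z] := codomP (sYf z zY).
have yzN := adj_neq ei yz.
have sub : symd [set y; z] Y = Y :\: [set y; z].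
  apply/setP=> x; rewrite !inE.
  have [->|_] := eqVneq x y; first by rewrite yY.
  by have [->|_] := eqVneq x z; first by rewrite zY.
have tw' := twist_trans (rpivot_twist es ei yz) tw; rewrite sub in tw'.
have uv : sedge u v by case: ef => _ ->; rewrite -def_y -def_z.
have leY'n : #|Y :\: [set y; z]| < n.
  rewrite -ltnS; apply: leq_ltn_trans leYn; apply: proper_card; apply/properP.
  by split; [exact: subsetDl | exists y; rewrite // !inE eqxx].
apply: (IHn _ leY'n (pivot u v) (rpivot e y z) f) => //.
- exact: rpivot_sym.
- exact: rpivot_irrefl.
- by rewrite def_y def_z; apply: emb_pivot.
- by move=> x /setDP[/sYf].
- exact: pr_pivot.
Qed.

Lemma restrict_reach (G : sgraph) e I : forall H (f : H -> T),
  emb e f -> {subset I <= codom f} -> pivot_reachable G H ->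
  exists K (g : K -> T), [/\ pivot_reachable G K, emb e g & codom g =i I].
Proof.
move=> H; have [n] := ubnP #|H|; elim: n H => // n IHn H leHn f ef sIf GH.
have [/forallP all|] := boolP [forall x, f x \in I].
  by exists H, f; split=> // x; apply/idP/idP => [/codomP[y ->]|/sIf].
rewrite negb_forall => /existsP[v vI].
have lt_n : #|del_vertex v| < n.
  rewrite -ltnS; apply: leq_ltn_trans leHn; rewrite card_sig /=.
  by rewrite -[X in _ < X](cardC (pred1 v)) card1.
apply: (IHn _ lt_n (f \o val)).
- exact: emb_del.
- move=> x xI; have [w def_x] := codomP (sIf x xI).
  have wv : w != v by apply: contraNneq vI => <-; rewrite -def_x.
  by rewrite def_x; apply: (codom_f (f \o val) (Sub w wv : del_vertex v)).
- exact: pr_del.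
Qed.

Lemma indep_minor H e e' (f : H -> T) Y I :
  symmetric e -> irreflexive e -> emb e f -> twist e Y e' ->
  {subset Y <= codom f} -> {subset I <= codom f} -> indep e' I ->
  has_pivot_minor H (edgeless #|I|).
Proof.
move=> es ei ef tw sYf sIf indI.
have [K [g [HK eg cg]]] := twist_reach es ei tw ef sYf (pr_refl H).
have sIg : {subset I <= codom g} by move=> x /sIf; rewrite cg.
have [L [h [HL [hi he] ch]]] := restrict_reach eg sIg HK.
exists L => //.
have cL : #|L| = #|I| by rewrite -(card_codom hi); apply: eq_card.
exists (cast_ord cL \o enum_rank).
  apply: bij_comp; last exact: enum_rank_bij.
  by exists (cast_ord (esym cL)); [exact: cast_ordK | exact: cast_ordKV].
by move=> x y /=; rewrite he indI // -ch codom_f.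
Qed.

End Embeddings.

(** Deletions can be postponed: each pivot is performed on all of [G], and a deletion only shrinks
    the embedding. *)
Lemma reach_emb (G K : sgraph) : pivot_reachable G K ->
  exists (e : rel G) (Y : {set G}) (f : K -> G),
    [/\ symmetric e, irreflexive e, twist (@sedge G) Y e & emb e f].
Proof.
elim=> [|{}K v _ [e [Y [f [es ei tw ef]]]]|{}K u v uv _ [e [Y [f [es ei tw ef]]]]].
- exists (@sedge G), set0, id; split; [exact: sedge_sym|exact: sedge_irrefl| |].
    exact: twist_refl.
  by split.
- by exists e, Y, (f \o val); split=> //; apply: emb_del.
- have fuv : e (f u) (f v) by case: ef => _ <-.
  exists (rpivot e (f u) (f v)), (symd Y [set f u; f v]), f; split.
  + exact: rpivot_sym.
  + exact: rpivot_irrefl.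
  + exact: twist_trans tw (twist_rpivot es ei fuv).
  + exact: emb_pivot.
Qed.

(** As [Y] avoids [v], the pivots realizing the exchange already live in the graph without [v]. *)
Lemma del_minor (H : sgraph) (e : rel H) (v : H) (Y I : {set H}) :
  twist (@sedge H) Y e -> v \notin Y -> v \notin I -> indep e I ->
  has_pivot_minor (del_vertex v) (edgeless #|I|).
Proof.
move=> tw vY vI indI.
have mem (X : {set H}) : v \notin X ->
    {subset X <= codom (val : del_vertex v -> H)}.
  move=> vX x xX; have xv : x != v by apply: contraNneq vX => <-.
  exact: (codom_f val (Sub x xv : del_vertex v)).
apply: (@indep_minor _ (del_vertex v) (@sedge H) e val Y I) => //; try exact: mem.
- exact: sedge_sym.
- exact: sedge_irrefl.
- by split=> //; apply: val_inj.
Qed.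

(** * Independent sets in twists of a pivot-unique graph *)

Section Unique.

Variables (t : nat) (G : sgraph).
Hypothesis hG : pivot_unique (edgeless t) G.

Implicit Types (e : rel G) (Y I : {set G}) (v : G).

Let es : symmetric (@sedge G) := @sedge_sym G.
Let ei : irreflexive (@sedge G) := @sedge_irrefl G.

(** A vertex of [Y] has a neighbour, so [contract] really pivots on some [zv]. Relative to the
    pivoted graph the exchange set no longer contains [v], and [del_minor] applies. *)
Lemma contract_minor e' v Y I : twist (@sedge G) Y e' -> v \in Y ->
  v \notin I -> indep e' I -> #|I| = t ->
  has_pivot_minor (contract v) (edgeless t).
Proof.
move=> tw vY vI indI <-; rewrite /contract; case: pickP => [z zv|none]; last first.
  by have [z _] := twist_neighbor es tw vY; rewrite es none.
apply: (@del_minor (pivot z v) e' v (symd [set z; v] Y) I) => //.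
  exact: twist_trans (rpivot_twist es ei zv) tw.
by rewrite !inE eqxx orbT vY.
Qed.

Lemma twist_unique e1 e2 Y1 Y2 I1 I2 v :
  twist (@sedge G) Y1 e1 -> twist (@sedge G) Y2 e2 ->
  (v \in Y1) != (v \in Y2) ->
  v \notin I1 -> v \notin I2 -> indep e1 I1 -> indep e2 I2 ->
  #|I1| = t -> #|I2| = t -> False.
Proof.
wlog vY : e1 e2 Y1 Y2 I1 I2 / v \notin Y1.
  move=> W tw1 tw2 d v1 v2 i1 i2 c1 c2.
  have [vY|vY] := boolP (v \in Y1); last by apply: (W e1 e2 Y1 Y2 I1 I2).
  apply: (W e2 e1 Y2 Y1 I2 I1) => //; last by rewrite eq_sym.
  by move: d; rewrite vY; case: (v \in Y2).
move=> tw1 tw2; rewrite (negbTE vY); case: (boolP (v \in Y2)) => // vY2 _.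
move=> v1 v2 i1 i2 c1 c2; case: hG => _ /(_ v); apply; split; last first.
  exact: contract_minor tw2 vY2 v2 i2 c2.
by rewrite -c1; apply: del_minor tw1 vY v1 i1.
Qed.

(** Being isolated passes back from [e] to [G], where deletion and contraction of [v] coincide; the
    same minor then counts for both. *)
Lemma isolated_unique e Y I v : twist (@sedge G) Y e -> e v =1 xpred0 ->
  v \notin I -> indep e I -> #|I| = t -> False.
Proof.
move=> tw iso vI indI cI.
have iso0 := twist_isolated es tw iso.
have vY : v \notin Y.
  apply: contraT; rewrite negbK => vY.
  by have [z _] := twist_neighbor es tw vY; rewrite iso0.
case: hG => _ /(_ v); apply.
have D : has_pivot_minor (del_vertex v) (edgeless t).
  by rewrite -cI; apply: del_minor tw vY vI indI.
split=> //; rewrite /contract; case: pickP => // z.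
by rewrite es iso0.
Qed.

(** The pivot on [zv] toggles whether [v] lies in the exchange set, so [twist_unique] applies to the
    graphs before and after it. *)
Lemma pivot_unique_indep e Y I v z :
  symmetric e -> irreflexive e -> twist (@sedge G) Y e ->
  v \notin I -> indep e I -> #|I| = t -> e z v ->
  ~ indep (rpivot e z v) I.
Proof.
move=> s i tw vI indI cI zv ind'.
apply: (twist_unique tw (twist_trans tw (twist_rpivot s i zv)) (v := v) _ vI vI
          indI ind' cI cI).
by rewrite !inE eqxx orbT; case: (v \in Y).
Qed.

(* The neighbourhood cannot be empty (pivot v with any neighbour) nor a
   singleton {z} (pivot zv): I would stay independent. *)
Lemma two_neighbors e Y I v :
  symmetric e -> irreflexive e -> twist (@sedge G) Y e ->
  v \notin I -> indep e I -> #|I| = t ->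
  1 < #|[set x in I | e v x]|.
Proof.
move=> s i tw vI indI cI; rewrite ltnNge; apply/negP => small.
have noI x : x \in I -> x != v by move=> xI; apply: contraNneq vI => <-.
have [/setP empty|[z /setIdP[zI vz]]] := set_0Vmem [set x in I | e v x].
  have nI x : x \in I -> e v x = false.
    by move=> xI; have := empty x; rewrite !inE xI.
  have [z vz|iso] := pickP (e v); last exact: isolated_unique tw iso vI indI cI.
  have zI x : x \in I -> x != z.
    by move=> xI; apply: contraTneq vz => <-; rewrite nI.
  have zv : e z v by rewrite s.
  apply: (pivot_unique_indep s i tw vI indI cI zv) => x y xI yI.
  by rewrite rpivot_out ?noI ?zI // indI // !nI // andbF.
have only x : x \in I -> x != z -> e v x = false.
  move=> xI xz; apply: contraNF xz => vx.
  by apply/eqP; apply: (card_le1_eqP small); rewrite inE ?xI ?zI.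
have zv : e z v by rewrite s.
apply: (pivot_unique_indep s i tw vI indI cI zv) => x y xI yI.
have ps := @rpivot_sym _ e z v s; have pi := @rpivot_irrefl _ e z v i.
have [->|xz] := eqVneq x z; have [->|yz] := eqVneq y z; rewrite ?pi //.
- by rewrite rpivot_l ?noI // only.
- by rewrite ps rpivot_l ?noI // only.
- by rewrite rpivot_out ?noI // indI // !only // andbF.
Qed.

Lemma neighbors_inj e Y I v w :
  symmetric e -> irreflexive e -> twist (@sedge G) Y e ->
  v \notin I -> w \notin I -> indep e I -> #|I| = t ->
  [set x in I | e v x] = [set x in I | e w x] -> v = w.
Proof.
move=> s i tw vI wI indI cI /setP eqN; apply/eqP; apply: contraT => vw.
have sameN x : x \in I -> e v x = e w x.
  by move=> xI; have := eqN x; rewrite !inE xI.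
have noI u x : u \notin I -> x \in I -> x != u.
  by move=> uI xI; apply: contraNneq uI => <-.
have /card_gt0P[z /setIdP[zI vz]] := ltnW (two_neighbors s i tw vI indI cI).
have zv : e z v by rewrite s.
have zw : e z w by rewrite s -sameN.
have ps := @rpivot_sym _ e z v s; have pi := @rpivot_irrefl _ e z v i.
pose J := v |: (I :\ z).
have wJ : w \notin J by rewrite !inE (eq_sym w) (negbTE vw) (negbTE wI) andbF.
have cJ : #|J| = t.
  by rewrite cardsU1 !inE (negbTE vI) andbF /= -cI [in RHS](cardsD1 z) zI.
have vJ x : x \in I -> x != z -> rpivot e z v v x = false.
  by move=> xI xz; rewrite (rpivot_r s i zv xz) ?indI ?(noI v).
have indJ : indep (rpivot e z v) J.
  move=> x y; rewrite !inE => /predU1P[->|/andP[xz xI]] /predU1P[->|/andP[yz yI]].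
  - by rewrite pi.
  - exact: vJ.
  - by rewrite ps vJ.
  - by rewrite (rpivot_out s i zv xz _ yz) ?(noI v) // [e x y]indI //
      [e z x]indI // [e z y]indI // andbF.
have := two_neighbors ps pi (twist_trans tw (twist_rpivot s i zv)) wJ indJ cJ.
rewrite ltnNge => /negP[]; rewrite -(cards1 v); apply: subset_leq_card.
apply/subsetP=> x; rewrite !inE => /andP[/predU1P[->|/andP[xz xI]]]; first by rewrite eqxx.
have wz : w != z by rewrite eq_sym noI.
have wv : w != v by rewrite eq_sym.
(* As [w] is adjacent to [z] and [z] has no neighbour in [I], the new adjacency of [w] and [x] is
   the sum of [e w x] and [e v x], which cancel. *)
rewrite (rpivot_out s i zv wz wv xz (noI _ _ vI xI)).
by rewrite zw [e z x]indI // andbF addbF /= sameN // addbb.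
Qed.

Lemma pivot_unique_card : #|G| <= 2 ^ t - 1.
Proof.
case: (hG) => -[K GK [h hb hh] _].
have [e [Y [f [s i tw [fi fe]]]]] := reach_emb GK.
pose I := [set f x | x in [set: K]].
have cI : #|I| = t by rewrite card_imset // cardsT (bij_eq_card hb) card_ord.
have indI : indep e I by move=> _ _ /imsetP[x _ ->] /imsetP[y _ ->]; rewrite -fe -hh.
(* By [two_neighbors] the size of [F x] reveals whether [x] is in [I], so the two branches cannot
   collide. *)
pose F x := if x \in I then [set x] else [set y in I | e x y].
have F1 x : (#|F x| == 1) = (x \in I).
  rewrite /F; case: ifPn => xI; first by rewrite cards1.
  by rewrite gtn_eqF // (two_neighbors s i tw xI indI cI).
have Finj : injective F.
  move=> x y Fxy; have := F1 x; rewrite Fxy F1 => eqI.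
  move: Fxy; rewrite /F eqI; case: ifPn => [_ /set1_inj //|xI].
  by apply: (neighbors_inj s i tw _ _ indI cI); rewrite ?eqI.
(* The values of [F] are nonempty subsets of [I]; removing [set0] from the powerset accounts for the
   subtracted 1. *)
rewrite -cardsT -(card_imset _ Finj) -cI -card_powerset.
have := cardsD1 set0 (powerset I); rewrite inE sub0set => ->; rewrite addKn.
apply: subset_leq_card; apply/subsetP=> _ /imsetP[x _ ->]; rewrite !inE /F.
case: ifPn => xI; first by rewrite sub1set xI andbT -cards_eq0 cards1.
rewrite -cards_eq0 -lt0n ltnW ?(two_neighbors s i tw) //=.
by apply/subsetP=> y /setIdP[].
Qed.

End Unique.

Theorem theorem4p6 (t : nat) (ht : 1 <= t) (G : sgraph)
  (hG : pivot_unique (edgeless t) G) : #|G| <= 2 ^ t - 1.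
Proof. exact: pivot_unique_card hG. Qed.
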